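(* Let $g\ge 2$ be a fixed integer. As $x\to\infty$, $$\#\{n\in\mathcal P(x)\,:\, n \text{ is prime}\}=O\!\left(\#\mathcal P(x)\,\frac{\log\log\log x}{\log\log x}\right),$$ where the implied constant depends only on $g$.
   Context: Fix an integer base $g\ge 2$. Every natural number $n$ has a base $g$ representation $n=\sum_{k=0}^{L-1}a_k(n)g^k$ with digits $a_k(n)\in\{0,1,\dots,g-1\}$ and leading digit $a_{L-1}(n)\neq 0$. The integer $n$ is a palindrome (in base $g$) if $a_k(n)=a_{L-1-k}(n)$ for all $k=0,\dots,L-1$. Let $\mathcal P$ be the set of base-$g$ palindromes and, for real $x>0$, $\mathcal P(x)=\{n\le x: n\in\mathcal P\}$. $\#S$ denotes the cardinality of a finite set $S$. *)

(* Defs.v *)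
From HB Require Import structures.
From mathcomp Require Export all_boot all_order all_algebra finmap.
From mathcomp Require Export all_classical all_reals all_analysis.
Export Order.TTheory GRing.Theory Num.Theory numFieldNormedType.Exports.

Set Implicit Arguments.
Unset Strict Implicit.
Unset Printing Implicit Defensive.

Local Open Scope classical_set_scope.
Local Open Scope fset_scope.
Local Open Scope ring_scope.

Definition base_repr (g n L : nat) (a : nat -> nat) : Prop :=
  [/\ (0 < L)%N,
      (forall k : nat, (k < L)%N -> (a k < g)%N),
      a L.-1 <> 0%N
    & n = (\sum_(k < L) a k * g ^ k)%N].

(* The base g representation is unique (base_repr_uniq below), so "some
   representation" is "the representation".  The integer 0 has none, as its
   leading digit would vanish; it is thus not a palindrome. *)
Definition palindrome (g n : nat) : Prop :=
  exists (L : nat) (a : nat -> nat), base_repr g n L a /\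
    forall k : nat, (k < L)%N -> a k = a (L.-1 - k)%N.

Definition palindromes_le (R : realType) (g : nat) (x : R) : set nat :=
  [set n | palindrome g n /\ n%:R <= x].

Definition prime_palindromes_le (R : realType) (g : nat) (x : R) : set nat :=
  [set n | palindromes_le g x n /\ prime n].

(* fset_set sends an infinite set to fset0; both sets above are finite
   (finite_palindromes_le, finite_prime_palindromes_le), so that #|` fset_set _|
   is their cardinality. *)
Lemma finite_palindromes_le (R : realType) (g : nat) (x : R) :
  finite_set (palindromes_le g x).
Proof.
apply: (@sub_finite_set _ _ `I_(Num.truncn x).+1); last exact: finite_II.
move=> n /= [_ nx]; rewrite ltnS -(natrK (R := R) n).
by apply: le_truncn.
Qed.

Lemma finite_prime_palindromes_le (R : realType) (g : nat) (x : R) :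
  finite_set (prime_palindromes_le g x).
Proof.
by apply: sub_finite_set (finite_palindromes_le g x) => n [].
Qed.

Lemma base_repr_exists (g n : nat) : (1 < g)%N -> (0 < n)%N ->
  exists (L : nat) (a : nat -> nat), base_repr g n L a.
Proof.
move=> g1; elim/ltn_ind: n => n IH n0.
have [ng|gn] := ltnP n g.
  exists 1%N, (fun=> n); split => //; last by rewrite big_ord1 expn0 muln1.
  by move=> n0'; rewrite n0' in n0.
have q0 : (0 < n %/ g)%N by rewrite divn_gt0 // ltnW.
have [L [a [L0 ag aL nE]]] := IH _ (ltn_Pdiv g1 n0) q0.
exists L.+1, (fun k => if k is k'.+1 then a k' else n %% g)%N; split => //.
- by case=> [_|k]; [rewrite ltn_mod ltnW | rewrite ltnS; exact: ag].
- by case: L L0 {ag nE} aL.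
rewrite big_ord_recl expn0 muln1 {1}(divn_eq n g) addnC; congr addn.
rewrite nE big_distrl /=; apply: eq_bigr => k _.
by rewrite /bump /= add1n expnSr mulnA.
Qed.

Lemma base_repr_uniq (g n L M : nat) (a b : nat -> nat) :
  base_repr g n L a -> base_repr g n M b ->
  L = M /\ forall k : nat, (k < L)%N -> a k = b k.
Proof.
elim: L n M a b => [n M a b []//|L IH] n M a b [_ ag aL nE].
have g0 : (0 < g)%N by apply: leq_ltn_trans (ag 0%N _).
case: M => [[]//|M] [_ bg bM].
have step K (c : nat -> nat) :
    (\sum_(k < K.+1) c k * g ^ k)%N =
    ((\sum_(k < K) c k.+1 * g ^ k * g) + c 0)%N.
  rewrite big_ord_recl expn0 muln1 addnC; congr addn.
  by apply: eq_bigr => k _; rewrite lift0 expnSr mulnA.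
rewrite step -big_distrl /= => nE'; rewrite step -big_distrl /= in nE.
have a0 : a 0%N = b 0%N.
  have : (n %% g = n %% g)%N by [].
  by rewrite {1}nE {1}nE' !modnMDl !modn_small ?ag ?bg.
have qE : (\sum_(k < L) a k.+1 * g ^ k = \sum_(k < M) b k.+1 * g ^ k)%N.
  have : (n %/ g = n %/ g)%N by [].
  by rewrite {1}nE {1}nE' !divnMDl // !divn_small ?ag ?bg // !addn0.
have pos K (c : nat -> nat) : c K.+1 <> 0%N ->
    (\sum_(k < K.+1) c k.+1 * g ^ k)%N <> 0%N.
  move=> cK /eqP; rewrite big_ord_recr /= addn_eq0 muln_eq0 => /andP[_ /orP[]].
    by move=> /eqP.
  by rewrite expn_eq0 eqn0Ngt g0.
case: L IH ag aL nE qE => [|L] IH ag aL nE qE;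
  case: M bg bM nE' qE => [|M] bg bM nE' qE.
- by split=> // -[].
- by have := pos _ _ bM; rewrite -qE big_ord0.
- by have := pos _ _ aL; rewrite qE big_ord0.
have ra : base_repr g (\sum_(k < L.+1) a k.+1 * g ^ k)%N L.+1 (a \o S).
  by split=> // k; exact: (ag k.+1).
have rb : base_repr g (\sum_(k < L.+1) a k.+1 * g ^ k)%N M.+1 (b \o S).
  by split=> // k; exact: (bg k.+1).
have [LM ab] := IH _ _ _ _ ra rb.
by rewrite LM; split=> // -[//|k]; rewrite ltnS -LM; exact: ab.
Qed.

(* Main.v *)
Require Import Defs.
From mathcomp Require Import ring lra zify.

(* A palindrome of length L is a sum of a_k w_k with free digits a_k and
   w_k = g^k + g^(L-1-k).  Modulo d coprime to g (g^2 - 1), two consecutive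
   weights generate Z/d, so by a Poincare inequality on Z/d convolution with
   two consecutive digits contracts the L^2 norm of mean-zero functions by a
   factor 1 - c/d^2.  Hence the palindromes of length L are equidistributed
   modulo every such d <= L^(1/4), with error exp(- c sqrt L).

   Brun's pure sieve then applies with primes up to z, where
   log z = c log L / log log L.  Instead of Chebyshev's bound on the sum of 1/p,
   which controls the truncation error, one sieves only by an initial segment of
   the primes: the shortest one for which the product of the 1 - 1/p drops below
   eta = C log log L / log L.  That product is then at least eta / 2, and this
   alone bounds the elementary symmetric functions of the 1/p.  Such a segment
   exists by the elementary inequality
   prod_(p <= z) (1 - 1/p) * log (z + 1) <= 1. *)

Set Implicit Arguments.
Unset Strict Implicit.
Unset Printing Implicit Defensive.

Local Open Scope classical_set_scope.
Local Open Scope fset_scope.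
Local Open Scope ring_scope.

(** * Convolution with digits on a finite abelian group *)

Section DigitOperators.
Variables (R : realFieldType) (V : finZmodType) (g : nat).
Implicit Types (f : V -> R) (w s x : V).

Definition digit_op w f x : R := \sum_(a < g) f (x + w *+ a).
Definition normsq f : R := \sum_x f x ^+ 2.
Definition energy s f : R := \sum_x (f (x + s) - f x) ^+ 2.

Lemma sum_translate (F : V -> R) s : \sum_x F (x + s) = \sum_x F x.
Proof. by rewrite [RHS](reindex_inj (addIr s)). Qed.

Lemma energy_ge0 s f : 0 <= energy s f.
Proof. by apply: sumr_ge0 => x _; exact: sqr_ge0. Qed.

Lemma sum_digit_op w f : \sum_x digit_op w f x = g%:R * \sum_x f x.
Proof.
rewrite exchange_big /= (eq_bigr (fun=> \sum_x f x)) => [|a _].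
  by rewrite sumr_const card_ord mulr_natl.
exact: sum_translate.
Qed.

Lemma digit_opC w w' f x :
  digit_op w (digit_op w' f) x = digit_op w' (digit_op w f) x.
Proof.
rewrite /digit_op exchange_big; apply: eq_bigr => a _; apply: eq_bigr => b _.
by rewrite addrAC.
Qed.

(** Cauchy-Schwarz with its defect, the sum of [(h a - h b) ^+ 2] over the pairs of digits. Only the
    pair 0, 1 is kept; summed over x it gives the energy. *)
Lemma normsq_digit_op w f : (2 <= g)%N ->
  normsq (digit_op w f) <= g%:R ^+ 2 * normsq f - energy w f.
Proof.
move=> g2; have sqr_sum_le (h : nat -> R) k :
    (\sum_(a < k.+2) h a) ^+ 2 + (h 1%N - h 0%N) ^+ 2
      <= k.+2%:R * \sum_(a < k.+2) h a ^+ 2.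
  elim: k => [|k IH]; first by rewrite !big_ord_recr !big_ord0 /=; nra.
  rewrite big_ord_recr [X in _ <= _ * X]big_ord_recr /=.
  have dev : 0 <= \sum_(a < k.+2) (h a - h k.+2) ^+ 2.
    by apply: sumr_ge0 => a _; exact: sqr_ge0.
  move: dev; rewrite (eq_bigr _ (fun a _ => sqrrB _ _)).
  rewrite big_split sumrB /= sumr_const card_ord sumrMnl -big_distrl /=.
  rewrite -[_ *+ k.+2]mulr_natl -[k.+3%:R]natr1; nra.
rewrite lerBrDr -big_split /= mulr_sumr.
have -> : \sum_x g%:R ^+ 2 * f x ^+ 2
        = \sum_x g%:R * \sum_(a < g) f (x + w *+ a) ^+ 2.
  rewrite -!mulr_sumr exchange_big /= expr2 -mulrA; congr (_ * _).
  rewrite [RHS](eq_bigr (fun=> \sum_x f x ^+ 2)) => [|a _].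
    by rewrite sumr_const card_ord mulr_natl.
  exact: (sum_translate (fun x => f x ^+ 2)).
apply: ler_sum => x _; rewrite /digit_op; case: g g2 => [|[|k]] // _.
by have := sqr_sum_le (fun a => f (x + w *+ a)) k; rewrite mulr1n mulr0n addr0.
Qed.

Lemma normsq_digit_op_le w f : (2 <= g)%N ->
  normsq (digit_op w f) <= g%:R ^+ 2 * normsq f.
Proof. by move=> /(normsq_digit_op w f); have := energy_ge0 w f; lra. Qed.

(** The triangle inequality for the L^2 norm, squared: translation by [w *+ i] is a chain of i
    translations by [w]. *)
Lemma energy_mulrn w f i : energy (w *+ i) f <= i%:R ^+ 2 * energy w f.
Proof.
case: i => [|i].
  rewrite mulr0n /energy big1 ?mul0r ?expr0n ?mul0r // => x _.
  by rewrite addr0 subrr expr0n.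
elim: i => [|i IH]; first by rewrite mulr1n expr1n mul1r.
have i0 : 0 < i.+1%:R :> R by rewrite ltr0n.
(* convexity: (a + b)^2 <= (1 + 1/i) a^2 + (1 + i) b^2 *)
have step : energy (w *+ i.+2) f <=
    (1 + i.+1%:R^-1) * energy (w *+ i.+1) f + (1 + i.+1%:R) * energy w f.
  have -> : energy w f
      = \sum_x (f (x + w *+ i.+1 + w) - f (x + w *+ i.+1)) ^+ 2.
    by rewrite (sum_translate (fun x => (f (x + w) - f x) ^+ 2)).
  rewrite !mulr_sumr -big_split; apply: ler_sum => x _ /=.
  rewrite -addrA -mulrSr; set a := f (x + _); set b := f (x + _ *+ i.+1).
  rewrite -subr_ge0.
  suff -> : (1 + i.+1%:R^-1) * (b - f x) ^+ 2 + (1 + i.+1%:R) * (a - b) ^+ 2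
      - (a - f x) ^+ 2
      = i.+1%:R^-1 * ((b - f x) - i.+1%:R * (a - b)) ^+ 2.
    by rewrite mulr_ge0 ?invr_ge0 ?sqr_ge0 // ltW.
  by field; rewrite lt0r_neq0.
apply: (le_trans step).
have -> : i.+2%:R ^+ 2 * energy w f
   = (1 + i.+1%:R^-1) * (i.+1%:R ^+ 2 * energy w f) + (1 + i.+1%:R) * energy w f.
  by rewrite -[i.+2%:R]natr1; field; rewrite lt0r_neq0.
by rewrite lerD2r ler_wpM2l // addr_ge0 // invr_ge0 ltW.
Qed.

Lemma energyD s s' f : energy (s + s') f <= 2 * energy s f + 2 * energy s' f.
Proof.
have -> : energy s' f = \sum_x (f (x + s + s') - f (x + s)) ^+ 2.
  by rewrite (sum_translate (fun x => (f (x + s') - f x) ^+ 2)).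
rewrite !mulr_sumr -big_split; apply: ler_sum => x _ /=; rewrite addrA.
set a := f (x + s + s'); set b := f (x + s); set c := f x; rewrite -subr_ge0.
suff -> : 2 * (b - c) ^+ 2 + 2 * (a - b) ^+ 2 - (a - c) ^+ 2
    = ((b - c) - (a - b)) ^+ 2 by exact: sqr_ge0.
ring.
Qed.

(** Through [energy_mulrn], the bounds on i and j become the factor [#|V|%:R ^+ 2] of the Poincare
    inequality. *)
Definition generating_pair w w' :=
  forall s, exists i j : nat,
    [/\ (i <= #|V|)%N, (j <= #|V|)%N & s = w *+ i + w' *+ j].

(** For mean-zero [f] the energies of all translations add up to 2 |V| times the squared norm, while
    each single one is at most 2 |V|^2 times the sum of the two energies on the right. *)
Lemma poincare w w' f : generating_pair w w' -> \sum_x f x = 0 ->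
  normsq f <= #|V|%:R ^+ 2 * (energy w f + energy w' f).
Proof.
move=> gen f0; set n : R := #|V|%:R.
have n0 : 0 < n by rewrite ltr0n; apply/card_gt0P; exists 0.
have total : \sum_s energy s f = 2 * n * normsq f.
  rewrite exchange_big /=.
  have rowE x : \sum_s (f (x + s) - f x) ^+ 2 = normsq f + n * f x ^+ 2.
    have -> : \sum_s (f (x + s) - f x) ^+ 2 = \sum_y (f y - f x) ^+ 2.
      by rewrite [RHS](reindex_inj (addrI x)).
    rewrite (eq_bigr _ (fun a _ => sqrrB _ _)) big_split sumrB /=.
    rewrite sumr_const sumrMnl -big_distrl /= f0 mul0r mul0rn.
    by rewrite subr0 mulr_natl.
  under eq_bigr do rewrite rowE.
  rewrite big_split /= sumr_const -mulr_sumr -mulr_natl -/n -/(normsq f); ring.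
suff : \sum_s energy s f <= \sum_(s : V) 2 * n ^+ 2 * (energy w f + energy w' f).
  rewrite total sumr_const -[_ *+ #|_|]mulr_natl -/n => le.
  by rewrite -(ler_pM2l (_ : 0 < 2 * n)) ?mulr_gt0 //; nra.
apply: ler_sum => s _; have [i [j [ni nj ->]]] := gen s.
have sq (k : nat) t : (k <= #|V|)%N -> energy (t *+ k) f <= n ^+ 2 * energy t f.
  move=> kn; apply: le_trans (energy_mulrn _ _ _) _.
  by rewrite ler_wpM2r ?energy_ge0 // lerXn2r ?nnegrE ?ler0n // ler_nat.
have := energyD (w *+ i) (w' *+ j) f; have := sq i w ni; have := sq j w' nj; nra.
Qed.

Definition contraction : R := 1 - (2 * g%:R ^+ 2 * #|V|%:R ^+ 2)^-1.

(** The inner operator loses its energy, and as the two commute, either can be the inner one.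
    Averaging both bounds loses half the sum of the energies, which the Poincare inequality bounds
    from below. *)
Lemma normsq_pair w w' f : (2 <= g)%N -> generating_pair w w' ->
  \sum_x f x = 0 ->
  normsq (digit_op w (digit_op w' f)) <= g%:R ^+ 4 * contraction * normsq f.
Proof.
move=> g2 gen f0; set n : R := #|V|%:R.
have n0 : 0 < n by rewrite ltr0n; apply/card_gt0P; exists 0.
have g0 : 0 < g%:R :> R by rewrite ltr0n; lia.
have h1 : normsq (digit_op w (digit_op w' f))
            <= g%:R ^+ 2 * (g%:R ^+ 2 * normsq f - energy w' f).
  apply: le_trans (normsq_digit_op_le _ _ g2) _.
  by rewrite ler_wpM2l ?sqr_ge0 // normsq_digit_op.
have h2 : normsq (digit_op w (digit_op w' f))
            <= g%:R ^+ 2 * (g%:R ^+ 2 * normsq f - energy w f).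
  have -> : digit_op w (digit_op w' f) = digit_op w' (digit_op w f).
    by apply/funext => x; exact: digit_opC.
  apply: le_trans (normsq_digit_op_le _ _ g2) _.
  by rewrite ler_wpM2l ?sqr_ge0 // normsq_digit_op.
have po := poincare gen f0; rewrite -/n in po.
have -> : g%:R ^+ 4 * contraction * normsq f
   = g%:R ^+ 2 * (g%:R ^+ 2 * normsq f - normsq f / n ^+ 2 / 2).
  by rewrite /contraction -/n; field; rewrite !lt0r_neq0.
have po' : normsq f / n ^+ 2 <= energy w f + energy w' f.
  by rewrite ler_pdivrMr ?exprn_gt0 // mulrC.
have : g%:R ^+ 2 * (normsq f / n ^+ 2)
    <= g%:R ^+ 2 * (energy w f + energy w' f) by rewrite ler_wpM2l ?sqr_ge0.
lra.
Qed.

Fixpoint digit_ops (ws : seq V) f : V -> R :=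
  if ws is w :: ws' then digit_op w (digit_ops ws' f) else f.

Lemma sum_digit_ops ws f : \sum_x f x = 0 -> \sum_x digit_ops ws f x = 0.
Proof. by move=> f0; elim: ws => //= w ws IH; rewrite sum_digit_op IH mulr0. Qed.

Lemma contraction_ge0 : (2 <= g)%N -> 0 <= contraction.
Proof.
move=> g2; have V0 : (0 < #|V|)%N by apply/card_gt0P; exists 0.
have E : 2 * g%:R ^+ 2 * #|V|%:R ^+ 2 = (2 * g ^ 2 * #|V| ^ 2)%:R :> R.
  by rewrite natrM natrM !natrX.
have pos : (0 < 2 * g ^ 2 * #|V| ^ 2)%N.
  by rewrite 2!muln_gt0 !expn_gt0 V0 (ltnW g2).
by rewrite /contraction E subr_ge0 invf_le1 ?ler1n // ltr0n.
Qed.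

Lemma normsq_digit_ops (w : nat -> V) f h j : (2 <= g)%N -> \sum_x f x = 0 ->
  (forall k, (j <= k)%N -> (k.+1 < j + h)%N -> generating_pair (w k) (w k.+1)) ->
  normsq (digit_ops [seq w k | k <- iota j h] f)
    <= (g%:R ^+ h) ^+ 2 * contraction ^+ h./2 * normsq f.
Proof.
move=> g2 f0; elim/ltn_ind: h j => -[|[|h]] IH j gen /=.
- by rewrite !expr0 expr1n !mul1r.
- by rewrite expr0 expr1 mulr1 normsq_digit_op_le.
have gj : generating_pair (w j) (w j.+1) by apply: gen; lia.
apply: le_trans (normsq_pair g2 gj _) _; first exact: sum_digit_ops.
have -> : (g%:R ^+ h.+2) ^+ 2 * contraction ^+ (h./2).+1 * normsq f
    = g%:R ^+ 4 * contraction * ((g%:R ^+ h) ^+ 2 * contraction ^+ h./2 * normsq f).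
  by rewrite -!exprM mulSn mulSn addnA exprD (exprS contraction); ring.
apply: ler_wpM2l; first by rewrite mulr_ge0 ?exprn_ge0 ?ler0n ?contraction_ge0.
by apply: IH => // k jk kh; apply: gen; lia.
Qed.
End DigitOperators.

(** * Equidistribution of palindromes *)

(** Listed with multiplicity, one entry per digit string, so that counts in the list are values of
    iterated operators [digit_op]. *)
Fixpoint digit_sums (g : nat) (ws : seq nat) : seq nat :=
  if ws is w :: ws' then
    [seq (a * w + v)%N | a <- iota 0 g, v <- digit_sums g ws']
  else [:: 0%N].

Lemma size_digit_sums g ws : size (digit_sums g ws) = (g ^ size ws)%N.
Proof. by elim: ws => //= w ws IH; rewrite size_allpairs size_iota IH expnS. Qed.

Lemma sum_digit_sums (R : realFieldType) (V : finZmodType) g (e : V) ws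
    (f : V -> R) x :
  \sum_(v <- digit_sums g ws) f (x + e *+ v)
    = digit_ops g [seq e *+ w | w <- ws] f x.
Proof.
elim: ws x => [|w ws IH] x /=; first by rewrite big_seq1 mulr0n addr0.
rewrite big_allpairs_dep /= /digit_op -[in iota 0 g](subn0 g).
rewrite -/(index_iota 0 g) big_mkord; apply: eq_bigr => a _; rewrite -IH.
by apply: eq_bigr => v _; rewrite mulrnDr mulnC mulrnA addrA.
Qed.

Definition palindrome_weight (g L k : nat) : nat := (g ^ k + g ^ (L.-1 - k))%N.

(** The middle digit of an odd length is its own mirror image. The outermost digit may vanish here,
    so not every digit string gives a palindrome of length [L]. *)
Definition palindrome_weights (g L : nat) : seq nat :=
  nseq (odd L) (g ^ L./2)%N ++ [seq palindrome_weight g L k | k <- iota 0 L./2].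

Lemma size_palindrome_weights g L : size (palindrome_weights g L) = uphalf L.
Proof. by rewrite size_cat size_nseq size_map size_iota uphalf_half. Qed.

(* The identity g w_{k+1} - w_k = g^k (g^2 - 1) makes any two consecutive
   weights generate the residues modulo d. *)
Lemma generating_palindrome_weight g L k d : (2 <= g)%N ->
  coprime d.+1 (g * (g ^ 2 - 1)) -> (k.+1 < L./2)%N ->
  generating_pair ((inZp 1 : 'I_d.+1) *+ palindrome_weight g L k)
                  ((inZp 1 : 'I_d.+1) *+ palindrome_weight g L k.+1).
Proof.
move=> g2; rewrite coprimeMr => /andP[cg cg2] kL s.
have valE n : val ((inZp 1 : 'I_d.+1) *+ n) = (n %% d.+1)%N.
  by rewrite Zp_mulrn /= modnMml mul1n.
set w := palindrome_weight g L k; set w' := palindrome_weight g L k.+1.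
have step : (g * w' = w + g ^ k * (g ^ 2 - 1))%N.
  rewrite /w /w' /palindrome_weight; have -> : (L.-1 - k = (L.-1 - k.+1).+1)%N by lia.
  have -> : (g ^ 2 = (g ^ 2 - 1).+1)%N by rewrite subn1 prednK // expn_gt0 ltnW.
  rewrite subn1 /= !expnS.
  have : (g * g = (g ^ 2 - 1).+1)%N by rewrite subn1 prednK ?expn_gt0 ?(ltnW g2).
  nia.
have cop : coprime (g ^ k * (g ^ 2 - 1)) d.+1.
  by rewrite coprimeMl coprimeXl coprime_sym.
have a0 : (0 < g ^ k * (g ^ 2 - 1))%N.
  by rewrite muln_gt0 expn_gt0 (ltnW g2) subn_gt0 -(exp1n 2) ltn_exp2r.
have [[c c'] /= cE] := coprimeP _ a0 cop.
(* With c inverse to [g ^ k * (g ^ 2 - 1)], one has s = s c (g w' - w) modulo [d.+1], and -1 is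
   represented by d. *)
exists ((s * c * d) %% d.+1)%N, ((s * c * g) %% d.+1)%N.
rewrite card_ord; split; try by rewrite ltnW // ltn_mod.
apply/val_inj; rewrite -!mulrnA -mulrnDr valE.
rewrite -modnDm !modnMmr modnDm.
have -> : (w * (s * c * d) + w' * (s * c * g)
   = (s * c * w + s * c') * d.+1 + s)%N.
  have cE' : (c * (g ^ k * (g ^ 2 - 1)) = c' * d.+1 + 1)%N by lia.
  have -> : (w' * (s * c * g) = s * c * (g * w'))%N by ring.
  have E : (s * c * (g ^ k * (g ^ 2 - 1)) = s * (c' * d.+1 + 1))%N.
    by rewrite -mulnA cE'.
  rewrite step mulnDr E; ring.
by rewrite modnMDl modn_small.
Qed.

(** The discrepancy is the value at 0 of the iterated operator applied to the centred indicator of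
    0, and a value is at most the L^2 norm. The two-sided weights form [L %/ 4] consecutive pairs,
    each contracting the squared norm; the square root turns the 2 of [contraction] into a 4. *)
Lemma count_digit_sums_dvdn (R : realType) g L d : (2 <= g)%N -> (0 < d)%N ->
  coprime d (g * (g ^ 2 - 1)) ->
  `|(count (dvdn d) (digit_sums g (palindrome_weights g L)))%:R
      - (g ^ uphalf L)%:R / d%:R|
    <= (g ^ uphalf L)%:R
       * expR (- ((L %/ 4)%:R / (4 * g%:R ^+ 2 * d%:R ^+ 2))) :> R.
Proof.
case: d => // d g2 _ cop; set ds := digit_sums _ _; set n : R := d.+1%:R.
have n0 : 0 < n by rewrite ltr0n.
have g0 : 0 < g%:R :> R by rewrite ltr0n ltnW.
pose f (x : 'I_d.+1) : R := (x == 0)%:R - n^-1.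
have sum_eq0 (c : R) : \sum_(x : 'I_d.+1) (x == 0)%:R * c = c.
  rewrite (bigD1 (0 : 'I_d.+1)) // eqxx mul1r big1 => [|x /negbTE ->].
    exact: addr0.
  exact: mul0r.
have f0 : \sum_x f x = 0.
  rewrite sumrB sumr_const card_ord -[X in X - _]mulr1 mulr_suml sum_eq0.
  by rewrite -[_ *+ _]mulr_natr mulVf ?subrr // lt0r_neq0.
have normf : normsq f <= 1.
  have -> : normsq f = \sum_(x : 'I_d.+1) ((x == 0)%:R * (1 - 2 / n) + n^-1 ^+ 2).
    by apply: eq_bigr => x _; rewrite /f; case: (x == 0); rewrite /=; ring.
  rewrite big_split /= sum_eq0 sumr_const card_ord -[n^-1 ^+ 2 *+ _]mulr_natr -/n.
  have -> : 1 - 2 / n + n^-1 ^+ 2 * n = 1 - n^-1 by field; rewrite lt0r_neq0.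
  by rewrite gerBl invr_ge0 ltW.
pose e : 'I_d.+1 := inZp 1.
have eE v : (e *+ v == 0) = (d.+1 %| v)%N.
  by rewrite -val_eqE /= Zp_mulrn /= modnMml mul1n.
have errE : (count (dvdn d.+1) ds)%:R - (g ^ uphalf L)%:R / n
    = digit_ops g [seq e *+ w | w <- palindrome_weights g L] f 0.
  rewrite -sum_digit_sums -/ds -(size_palindrome_weights g L) -size_digit_sums -/ds.
  rewrite (eq_bigr (fun v => (d.+1 %| v)%:R - n^-1)); last first.
    by move=> v _; rewrite add0r /f eE.
  rewrite sumrB; congr (_ - _); last first.
    by rewrite big_const_seq iter_addr_0 count_predT mulr_natl.
  by rewrite -sum1_count natr_sum big_mkcond; apply: eq_bigr => v _; case: dvdn.
set F := digit_ops _ _ f in errE.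
have normF : normsq F <= (g%:R ^+ uphalf L) ^+ 2 * contraction R 'I_d.+1 g ^+ (L %/ 4).
  pose h := L./2.
  have base : normsq (digit_ops g [seq e *+ palindrome_weight g L k | k <- iota 0 h] f)
      <= (g%:R ^+ h) ^+ 2 * contraction R 'I_d.+1 g ^+ (L %/ 4).
    have -> : (L %/ 4 = h./2)%N by rewrite /h -!divn2 -divnMA.
    apply: le_trans (normsq_digit_ops g2 f0 _) _.
      by move=> k _ kh; apply: generating_palindrome_weight.
    by rewrite ler_piMr // mulr_ge0 ?sqr_ge0 // exprn_ge0 // contraction_ge0.
  rewrite /F /palindrome_weights map_cat map_nseq -map_comp uphalf_half.
  case: (odd L); rewrite /= ?add0n // add1n.
  apply: le_trans (normsq_digit_op_le _ _ g2) _.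
  by rewrite (exprS g%:R L./2) exprMn -[leRHS]mulrA ler_wpM2l ?sqr_ge0.
have rho_le : contraction R 'I_d.+1 g ^+ (L %/ 4)
    <= expR (- ((L %/ 4)%:R / (4 * g%:R ^+ 2 * n ^+ 2))) ^+ 2.
  have -> : expR (- ((L %/ 4)%:R / (4 * g%:R ^+ 2 * n ^+ 2))) ^+ 2
      = expR (- (2 * g%:R ^+ 2 * n ^+ 2)^-1) ^+ (L %/ 4).
    rewrite -!expRM_natl; congr expR; field.
    by rewrite !lt0r_neq0.
  rewrite lerXn2r ?nnegrE ?contraction_ge0 ?expR_ge0 //.
  by rewrite /contraction card_ord -/n; exact: expR_ge1Dx.
rewrite errE -(ler_pXn2r (_ : 0 < 2)%N) ?nnegrE ?mulr_ge0 ?expR_ge0 //.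
rewrite real_normK ?num_real // exprMn natrX.
have F0 : F 0 ^+ 2 <= normsq F.
  by rewrite /normsq (bigD1 0) //= lerDl sumr_ge0 // => x _; exact: sqr_ge0.
apply: le_trans F0 (le_trans normF _).
by rewrite ler_wpM2l // sqr_ge0.
Qed.

(** * Brun's pure sieve *)

Section Bonferroni.
Variable R : realFieldType.
Implicit Types (xs : seq R) (m : nat).

Fixpoint elem_sym m xs : R :=
  if xs is x :: xs' then
    elem_sym m xs' + (if m is m'.+1 then x * elem_sym m' xs' else 0)
  else (m == 0%N)%:R.

(** The alternating sum of the elementary symmetric functions of degree at most m, in the recursive
    form along which the sieve is expanded. *)
Fixpoint trunc_incl_excl m xs : R :=
  if xs is x :: xs' then
    trunc_incl_excl m xs' - (if m is m'.+1 then x * trunc_incl_excl m' xs' else 0)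
  else 1.

Definition unit_interval xs := {in xs, forall x, 0 <= x <= 1}.

Lemma unit_interval_cons x xs : unit_interval (x :: xs) ->
  [/\ 0 <= x, x <= 1 & unit_interval xs].
Proof.
move=> h; have /andP[x0 x1] := h x (mem_head _ _).
by split=> // y yxs; apply: h; rewrite inE yxs orbT.
Qed.

Lemma prod_1B_itv xs : unit_interval xs ->
  0 <= \prod_(x <- xs) (1 - x) <= 1.
Proof.
elim: xs => [_|x xs IH /unit_interval_cons[x0 x1 /IH/andP[p0 p1]]].
  by rewrite big_nil ler01 lexx.
rewrite big_cons; apply/andP; split; nra.
Qed.

Lemma elem_sym0 xs : elem_sym 0 xs = 1.
Proof. by elim: xs => //= x xs ->; rewrite addr0. Qed.

(** The signed error for [x :: xs] at level m + 1 is that of [xs] at m + 1 plus x times that of [xs]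
    at m, and the upper bounds add up likewise. Real entries in [0, 1] cover both divisibility
    indicators and reciprocals of primes. *)
Lemma bonferroni m xs : unit_interval xs ->
  0 <= (-1) ^+ m * (trunc_incl_excl m xs - \prod_(x <- xs) (1 - x))
    <= elem_sym m.+1 xs.
Proof.
elim: xs m => [|x xs IH] m h.
  by rewrite big_nil /= subrr mulr0 lexx.
have [x0 x1 hxs] := unit_interval_cons h.
have /andP[p0 p1] := prod_1B_itv hxs.
rewrite big_cons; set P := \prod_(_ <- _) _ in p0 p1 IH *.
case: m => [|m] /=.
  have /andP[] := IH 0%N hxs; rewrite expr0 elem_sym0 /=.
  by move=> a b; apply/andP; split; nra.
have /andP[] := IH m.+1 hxs; have /andP[] := IH m hxs; rewrite !exprS.
set s := (-1) ^+ m; set A := trunc_incl_excl _ _; set B := trunc_incl_excl _ _.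
move=> a b c d.
have -> : -1 * s * (B - x * A - (1 - x) * P)
    = -1 * s * (B - P) + x * (s * (A - P)) by ring.
apply/andP; split; first by rewrite addr_ge0 // mulr_ge0.
by rewrite lerD // ler_wpM2l.
Qed.

Lemma elem_sym_ge0 m xs : unit_interval xs -> 0 <= elem_sym m xs.
Proof.
elim: xs m => [|x xs IH] m /=; first by rewrite ler0n.
move=> /unit_interval_cons[x0 x1 h]; rewrite addr_ge0 ?IH //.
by case: m => // m; rewrite mulr_ge0 ?IH.
Qed.

(** A generating function bound: [elem_sym m xs * 2 ^+ m] is at most the product of the 1 + 2 x, and
    (1 + 2 x) (1 - x)^2 <= 1. *)
Lemma elem_sym_le m xs : unit_interval xs ->
  elem_sym m xs * 2 ^+ m * (\prod_(x <- xs) (1 - x)) ^+ 2 <= 1.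
Proof.
elim: xs m => [|x xs IH] m.
  by rewrite big_nil expr1n mulr1 /=; case: m => [|m]; rewrite ?expr0 ?mul1r ?mul0r.
move=> /unit_interval_cons[x0 x1 h]; rewrite big_cons exprMn.
set P := \prod_(_ <- _) _ in IH *.
have factor_le1 : (1 + 2 * x) * (1 - x) ^+ 2 <= 1 by nra.
suff : elem_sym m (x :: xs) * 2 ^+ m * P ^+ 2 <= 1 + 2 * x.
  move=> le; apply: le_trans factor_le1.
  rewrite mulrCA mulrC ler_wpM2r ?sqr_ge0 //.
rewrite /= mulrDl mulrDl lerD ?IH //; case: m => [|m]; first by rewrite !mul0r mulr_ge0.
rewrite exprS.
have -> : x * elem_sym m xs * (2 * 2 ^+ m) * P ^+ 2
   = 2 * x * (elem_sym m xs * 2 ^+ m * P ^+ 2) by ring.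
by rewrite ler_piMr ?IH // mulr_ge0.
Qed.

(** Every factor is at least 1/2, so the first prefix product that is at most eta cannot have
    dropped below eta / 2. *)
Lemma prefix_prod_between (T : eqType) (F : T -> R) (l : seq T) eta :
  {in l, forall t, 0 <= F t <= 2^-1} -> eta <= 1 ->
  \prod_(t <- l) (1 - F t) <= eta ->
  exists s r, l = s ++ r /\ eta / 2 <= \prod_(t <- s) (1 - F t) <= eta.
Proof.
move=> + eta1; elim/last_ind: l => [|l t IH] F2.
  rewrite big_nil => eta1'; exists [::], [::]; split=> //.
  by rewrite big_nil eta1' andbT; lra.
have Fl : {in l, forall u, 0 <= F u <= 2^-1}.
  by move=> u ul; apply: F2; rewrite mem_rcons inE ul orbT.
have [/(IH Fl)[s [r [-> h]]] _|lt le] := leP (\prod_(t <- l) (1 - F t)) eta.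
  by exists s, (rcons r t); rewrite rcons_cat.
exists (rcons l t), [::]; rewrite cats0 le andbT; split=> //.
have /andP[t0 t2] : 0 <= F t <= 2^-1 by apply: F2; rewrite mem_rcons mem_head.
have : 0 <= \prod_(t <- l) (1 - F t).
  by rewrite big_seq; apply: prodr_ge0 => x xl; have := Fl x xl; lra.
by rewrite big_rcons /=; move: lt; set P := \prod_(_ <- _) _; nra.
Qed.
End Bonferroni.

(** * The sieve bound from equidistribution up to level [D] *)

Section BrunSieve.
Variables (R : realFieldType) (vs : seq nat) (X eps : R) (D B z : nat).
Hypothesis z0 : (0 < z)%N.
Hypothesis equidistributed : forall d, (0 < d)%N -> (d <= D)%N -> coprime d B ->
  `|(count (dvdn d) vs)%:R - X / d%:R| <= eps.

Let dvd_indicators (l : seq nat) v : seq R := [seq (p %| v)%:R | p <- l].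
Let inverses (l : seq nat) : seq R := [seq p%:R^-1 | p <- l].

(** Here [d] is the product of the primes already chosen. Choosing another p <= z replaces d by d p
    and lowers m by one, which preserves the budget [d * z ^ m <= D]. Each prime at most doubles the
    error. *)
Lemma sum_trunc_incl_excl m l d :
  uniq l -> {in l, forall p, [/\ prime p, (p <= z)%N, coprime p B & coprime p d]} ->
  (0 < d)%N -> coprime d B -> (d * z ^ m <= D)%N ->
  `|\sum_(v <- vs) (d %| v)%:R * trunc_incl_excl m (dvd_indicators l v)
      - X / d%:R * trunc_incl_excl m (inverses l)| <= 2 ^+ size l * eps.
Proof.
elim: l m d => [|p l IH] m d /=.
  move=> _ _ d0 dB dD; rewrite expr0 mul1r mulr1.
  rewrite (eq_bigr (fun v => (d %| v)%:R)) => [|v _]; last by rewrite mulr1.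
  have -> : \sum_(v <- vs) (d %| v)%:R = (count (dvdn d) vs)%:R :> R.
    by rewrite -sum1_count natr_sum [RHS]big_mkcond; apply: eq_bigr => v _; case: dvdn.
  apply: equidistributed => //; apply: leq_trans dD.
  by rewrite leq_pmulr // expn_gt0 z0.
move=> /andP[pl ul] hl d0 dB dD.
have [pp pz pB pd] := hl p (mem_head _ _).
have hl' : {in l, forall q, [/\ prime q, (q <= z)%N, coprime q B & coprime q d]}.
  by move=> q ql; apply: hl; rewrite inE ql orbT.
have IH1 := IH m d ul hl' d0 dB dD.
case: m dD IH1 => [|m] dD IH1.
  apply: le_trans (_ : 2 ^+ size l * eps <= _).
    rewrite subr0 (eq_bigr (fun v => (d %| v)%:R
      * trunc_incl_excl 0 (dvd_indicators l v))) // => v _.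
    by rewrite subr0.
  have : 0 <= 2 ^+ size l * eps by apply: le_trans IH1.
  by rewrite exprS; lra.
have IH2 : `|\sum_(v <- vs) (d * p %| v)%:R * trunc_incl_excl m (dvd_indicators l v)
      - X / (d * p)%:R * trunc_incl_excl m (inverses l)| <= 2 ^+ size l * eps.
  apply: IH => //.
  - move=> q ql; have [qp qz qB qd] := hl' q ql; split=> //.
    rewrite coprimeMr qd prime_coprime // dvdn_prime2 //.
    by apply: contraNneq pl => <-.
  - by rewrite muln_gt0 d0 prime_gt0.
  - by rewrite coprimeMl dB.
  - by apply: leq_trans dD; rewrite -mulnA leq_mul2l expnS leq_mul2r pz !orbT.
have -> : \sum_(v <- vs) (d %| v)%:R * (trunc_incl_excl m.+1 (dvd_indicators l v)
       - (p %| v)%:R * trunc_incl_excl m (dvd_indicators l v))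
   = \sum_(v <- vs) (d %| v)%:R * trunc_incl_excl m.+1 (dvd_indicators l v)
     - \sum_(v <- vs) (d * p %| v)%:R * trunc_incl_excl m (dvd_indicators l v).
  rewrite -sumrB; apply: eq_bigr => v _.
  rewrite Gauss_dvd 1?coprime_sym // mulrBr mulrA.
  by case: (d %| v)%N; case: (p %| v)%N; rewrite /= ?mul0r ?mul1r ?mul0r.
have p0 : p%:R != 0 :> R by rewrite pnatr_eq0 -lt0n prime_gt0.
have d0' : d%:R != 0 :> R by rewrite pnatr_eq0 -lt0n.
have -> : 2 ^+ (size l).+1 * eps = 2 ^+ size l * eps + 2 ^+ size l * eps.
  by rewrite exprS; ring.
move: IH1 IH2; set S := \sum_(_ <- _) _; set S' := \sum_(_ <- _) _.
set T := trunc_incl_excl m.+1 _; set T' := trunc_incl_excl m _ => IH1 IH2.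
have -> : S - S' - X / d%:R * (T - p%:R^-1 * T')
   = (S - X / d%:R * T) - (S' - X / (d * p)%:R * T').
  by rewrite natrM; field; apply/andP.
by apply: le_trans (ler_normB _ _) _; rewrite lerD.
Qed.

(** For even m the truncated sum dominates the indicator of the unsieved entries. Its main term is
    at most X (P + e), with P the product and e the next symmetric function; [elem_sym_le], P >= eta
    / 2 and the hypothesis on [eta ^+ 3] give e <= eta. *)
Lemma brun_sieve m l eta : ~~ odd m -> 0 <= X -> 0 < eta ->
  4 <= eta ^+ 3 * 2 ^+ m.+1 -> (z ^ m <= D)%N ->
  uniq l -> {in l, forall p, [/\ prime p, (p <= z)%N & coprime p B]} ->
  eta / 2 <= \prod_(p <- l) (1 - p%:R^-1) <= eta ->
  (count (fun v => ~~ has (fun p => p %| v)%N l) vs)%:R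
    <= 2 * eta * X + 2 ^+ size l * eps.
Proof.
move=> em X0 eta0 eta3 zD ul hl /andP[P1 P2].
have unit_inv : unit_interval (inverses l).
  move=> x /mapP[p pl ->]; have [pp _ _] := hl p pl.
  by rewrite invr_ge0 ler0n invf_le1 ?ler1n ?ltr0n ?prime_gt0.
have unit_ind v : unit_interval (dvd_indicators l v).
  by move=> x /mapP[p _ ->]; case: dvdn; rewrite /= ?ler01 ?lexx.
have sgn1 : (-1) ^+ m = 1 :> R by rewrite -signr_odd (negbTE em).
have /andP[_] := bonferroni m unit_inv; rewrite sgn1 mul1r big_map => upper.
have := elem_sym_le m.+1 unit_inv; rewrite big_map.
set P := \prod_(_ <- _) _ in upper P1 P2 *; set e := elem_sym _ _ in upper * => e_le.
have e0 : 0 <= e by exact: elem_sym_ge0.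
have eeta : e <= eta.
  rewrite leNgt; apply/negP => lt.
  have : e * 2 ^+ m.+1 * (eta / 2) ^+ 2 <= 1.
    apply: le_trans e_le; rewrite ler_wpM2l ?mulr_ge0 ?exprn_ge0 //.
    by rewrite lerXn2r // nnegrE; lra.
  have : eta * 2 ^+ m.+1 * (eta / 2) ^+ 2 < e * 2 ^+ m.+1 * (eta / 2) ^+ 2.
    by rewrite !ltr_pM2r ?exprn_gt0 // divr_gt0.
  have -> : eta * 2 ^+ m.+1 * (eta / 2) ^+ 2 = eta ^+ 3 * 2 ^+ m.+1 / 4 by field.
  by lra.
have main : \sum_(v <- vs) trunc_incl_excl m (dvd_indicators l v)
    <= X * trunc_incl_excl m (inverses l) + 2 ^+ size l * eps.
  have := @sum_trunc_incl_excl m l 1 ul _ isT (coprime1n _).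
  rewrite mul1n divr1 => /(_ _ zD) h.
  rewrite -lerBlDl; apply: le_trans (ler_norm _) (le_trans _ (h _)).
    rewrite (eq_bigr (fun v => (1 %| v)%:R
      * trunc_incl_excl m (dvd_indicators l v))) // => v _.
    by rewrite dvd1n mul1r.
  by move=> p pl; have [pp pz pB] := hl p pl; split=> //; rewrite coprimen1.
apply: le_trans (le_trans main _); last first.
  rewrite lerD2r mulrC ler_wpM2r //; lra.
rewrite -sum1_count natr_sum big_mkcond; apply: ler_sum => v _.
have /andP[+ _] := bonferroni m (unit_ind v); rewrite sgn1 mul1r subr_ge0.
apply: le_trans; rewrite big_map.
case: (boolP (has _ _)) => [|/hasPn nh] /=.
  by move=> _; apply: prodr_ge0 => p _; case: dvdn; rewrite /= ?subr0 ?subrr.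
rewrite big_seq big1 // => p pl.
by rewrite (negbTE (nh p pl)) subr0.
Qed.
End BrunSieve.

(** * An elementary upper bound for the product of the 1 - 1/p *)

Section Mertens.
Variable R : realType.

Lemma sum_multiples (F : nat -> R) p N : (0 < p)%N ->
  \sum_(1 <= n < N.+1 | (p %| n)%N) F n = \sum_(1 <= n < (N %/ p).+1) F (p * n)%N.
Proof.
move=> p0; elim: N => [|N IH]; first by rewrite div0n !big_geq.
rewrite big_mkcond big_nat_recr //= -big_mkcond IH divnS //.
have [dv|_] := boolP (p %| N.+1)%N; last by rewrite addr0 add0n.
rewrite add1n [RHS]big_nat_recr //=; congr (_ + F _).
by rewrite -[LHS](divnK dv) divnS // dv mulnC.
Qed.

Lemma harmonic_ge_ln N : ln N.+1%:R <= \sum_(1 <= n < N.+1) n%:R^-1 :> R.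
Proof.
elim: N => [|N IH]; first by rewrite ln1 big_geq.
rewrite big_nat_recr //=; have N0 : 0 < N.+1%:R :> R by rewrite ltr0n.
have -> : N.+2%:R = N.+1%:R * (1 + N.+1%:R^-1) :> R.
  by rewrite -[N.+2%:R]natr1; field; rewrite lt0r_neq0.
have i0 : 0 < N.+1%:R^-1 :> R by rewrite invr_gt0.
rewrite lnM ?posrE //.
by rewrite lerD // le_ln1Dx // (lt_trans _ i0) // ltrN10.
Qed.

(** One more prime p removes the numbers p n with n <= N / p unsieved by the others, hence at most
    1/p of the sum. *)
Lemma sieved_harmonic_ge l N : uniq l -> all prime l ->
  \prod_(p <- l) (1 - p%:R^-1) * \sum_(1 <= n < N.+1) n%:R^-1
    <= \sum_(1 <= n < N.+1 | ~~ has (fun p => p %| n)%N l) n%:R^-1 :> R.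
Proof.
elim: l => [|p l IH] /=; first by rewrite big_nil mul1r.
move=> /andP[pl ul] /andP[pp pr].
set G := \sum_(1 <= n < _ | ~~ has _ l) _ in IH.
have p0 : 0 < p%:R :> R by rewrite ltr0n prime_gt0.
have p1 : p%:R^-1 <= 1 :> R by rewrite invf_le1 // ler1n prime_gt0.
have mult : \sum_(1 <= n < N.+1 | ~~ has (fun q => q %| n)%N l && (p %| n)%N) n%:R^-1
    <= p%:R^-1 * G :> R.
  rewrite (eq_bigl (fun n => (p %| n) && ~~ has (fun q => q %| n) l)%N); last first.
    by move=> n; rewrite andbC.
  rewrite big_mkcondr sum_multiples ?prime_gt0 // /G mulr_sumr.
  rewrite [leRHS](big_cat_nat (n := (N %/ p).+1)) //=; last by rewrite ltnS leq_div.
  rewrite ler_wpDr //.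
    by apply: sumr_ge0 => n _; rewrite mulr_ge0 // invr_ge0.
  rewrite [leRHS]big_mkcond; apply: ler_sum => n _.
  have -> : has (fun q => q %| p * n)%N l = has (fun q => q %| n)%N l.
    apply: eq_in_has => q ql; have qp : prime q by exact: (allP pr).
    rewrite Euclid_dvdM // dvdn_prime2 //.
    by have /negbTE -> : q != p by apply: contraNneq pl => <-.
  by case: ifP => _; rewrite ?mulr0 // natrM invfM.
rewrite big_cons.
have split : G
   = \sum_(1 <= n < N.+1 | ~~ ((p %| n)%N || has (fun q => q %| n)%N l)) n%:R^-1
   + \sum_(1 <= n < N.+1 | ~~ has (fun q => q %| n)%N l && (p %| n)%N) n%:R^-1.
  rewrite addrC /G (bigID (fun n => p %| n)%N) /=; congr (_ + _).
  by apply: eq_bigl => n; rewrite negb_or andbC.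
rewrite -mulrA; apply: le_trans (_ : (1 - p%:R^-1) * G <= _).
  by rewrite ler_wpM2l ?subr_ge0 // IH.
by move: split mult; lra.
Qed.

(** Sieving 1, ..., N by all primes up to N leaves only 1, so the sieved harmonic sum equals 1. *)
Lemma prod_primes_le (N : nat) : (0 < N)%N ->
  \prod_(p <- [seq p <- iota 0 N.+1 | prime p]) (1 - p%:R^-1) * ln N.+1%:R <= 1 :> R.
Proof.
move=> N0; set l := [seq p <- iota 0 N.+1 | prime p].
have pr : all prime l by exact: filter_all.
have inv1 p : p \in l -> 0 <= 1 - p%:R^-1 :> R.
  move=> pl; have pp : prime p by exact: (allP pr).
  by rewrite subr_ge0 invf_le1 ?ler1n ?ltr0n ?prime_gt0.
apply: le_trans (_ : \prod_(p <- l) (1 - p%:R^-1) * \sum_(1 <= n < N.+1) n%:R^-1 <= _).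
  by rewrite ler_wpM2l ?harmonic_ge_ln // big_seq prodr_ge0.
apply: le_trans (sieved_harmonic_ge _ _ pr) _.
  by rewrite filter_uniq // iota_uniq.
rewrite big_mkcond big_ltn //= big_nat_cond big1 ?addr0.
  by case: ifP => _; rewrite ?invr1.
move=> n /andP[/andP[n1 nN] _]; case: ifP => // /negP[].
apply/hasP; exists (pdiv n); last exact: pdiv_dvd.
rewrite mem_filter pdiv_prime // mem_iota /= add0n ltnS.
by apply: leq_trans (pdiv_leq (ltnW n1)) _; lia.
Qed.
End Mertens.

(** At most B + 1 primes divide B, and dropping the factor of each costs at most 2. *)
Lemma prod_coprime_primes_le (R : realType) B N : (0 < B)%N -> (0 < N)%N ->
  \prod_(p <- [seq p <- iota 0 N.+1 | prime p && coprime p B]) (1 - p%:R^-1)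
    * ln N.+1%:R <= 2 ^+ B.+1 :> R.
Proof.
move=> B0 N0; set P := \prod_(_ <- _) _.
pose s := [seq p <- iota 0 N.+1 | prime p && ~~ coprime p B].
have half p : prime p -> 2^-1 <= 1 - p%:R^-1 :> R.
  move=> pp; have p2 : 2 <= p%:R :> R by rewrite ler_nat prime_gt1.
  have : p%:R^-1 <= 2^-1 :> R by rewrite lef_pV2 ?posrE //; lra.
  lra.
have P0 : 0 <= P.
  rewrite /P big_filter prodr_ge0 // => p /andP[/half]; lra.
have size_s : (size s <= B.+1)%N.
  rewrite -(size_iota 0 B.+1); apply: uniq_leq_size.
    by rewrite filter_uniq // iota_uniq.
  move=> p; rewrite mem_filter mem_iota => /andP[/andP[pp pB] _].
  rewrite mem_iota /= add0n ltnS dvdn_leq //.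
  by move: pB; rewrite prime_coprime // negbK.
have s_ge : 2^-1 ^+ B.+1 <= \prod_(p <- s) (1 - p%:R^-1) :> R.
  have le1 : 2^-1 ^+ B.+1 <= 2^-1 ^+ size s :> R.
    by apply: ler_wiXn2l => //; lra.
  apply: le_trans le1 _; have : all prime s.
    by apply/allP => p; rewrite mem_filter => /andP[/andP[]].
  elim: (s) => [|p t IH] /=; first by rewrite big_nil.
  move=> /andP[/half pp /IH tp]; rewrite big_cons exprS ler_pM ?exprn_ge0 //; lra.
have := @prod_primes_le R N N0; rewrite big_filter (bigID (fun p => coprime p B)) /=.
rewrite -[X in X * _ * _]big_filter -[X in _ * X * _]big_filter -/P -/s.
set S := \prod_(_ <- _) _ in s_ge *; set T := ln _.
have T0 : 0 <= T by rewrite ln_ge0 // ler1n.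
move=> le1; have PT0 : 0 <= P * T by rewrite mulr_ge0.
have : P * T * 2^-1 ^+ B.+1 <= 1.
  by apply: le_trans le1; rewrite [leRHS]mulrAC ler_wpM2l.
by rewrite exprVn ler_pdivrMr ?exprn_gt0 // mul1r.
Qed.

(** * Choice of the sieve parameters *)

Definition bad_modulus (g : nat) := (g * (g ^ 2 - 1))%N.
(* The factor 32 comes from the choice log z = v / (32 log v) of the sieving
   range; the power of 2 compensates for the primes dividing the bad modulus. *)
Definition sieve_constant (R : realType) (g : nat) : R :=
  32 * 2 ^+ (bad_modulus g).+1.
Definition sieve_density (R : realType) (g : nat) (v : R) : R :=
  sieve_constant R g * (ln v / v).

Lemma bad_modulus_gt0 g : (2 <= g)%N -> (0 < bad_modulus g)%N.
Proof.
move=> g2; rewrite muln_gt0 (ltnW g2) subn_gt0 -[X in (X < _)%N](exp1n 2).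
by rewrite ltn_exp2r.
Qed.

Lemma sieve_density_ge (R : realType) (g : nat) (v : R) : 0 < v -> 1 <= ln v ->
  2 / v <= sieve_density g v.
Proof.
move=> v0 lv; rewrite /sieve_density /sieve_constant mulrA ler_pM2r ?invr_gt0 //.
have : 1 <= 2 ^+ (bad_modulus g).+1 :> R by rewrite exprn_ege1 //; lra.
set q := 2 ^+ _; nra.
Qed.

Lemma expR1_le4 (R : realType) : expR 1 <= 4 :> R.
Proof.
have := expR_ge1Dx (- 2^-1 : R); rewrite expRN.
have e0 := expR_gt0 (2^-1 : R).
have -> : expR 1 = expR (2^-1) ^+ 2 :> R.
  by rewrite -expRM_natl; congr expR; field.
move=> h.
have : expR 2^-1 <= 2 :> R.
  rewrite -[leRHS]invrK -[leLHS]invrK lef_pV2 ?posrE ?invr_gt0 //; lra.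
nra.
Qed.

(** Take t = v / (32 ln v), z the integer part of exp t and m = 2 M with 3 ln v <= M <= 4 ln v, an
    interval of length at least 1. Then m t <= v / 4, whence the 32, and 2^m = 4^M >= exp M >=
    v^3. *)
Lemma sieve_parameters (R : realType) (v : R) : expR 1 <= v ->
  exists z m : nat, [/\ (0 < z)%N, ~~ odd m, v / (32 * ln v) <= ln z.+1%:R,
    z%:R <= expR (v / 4) /\ (z ^ m)%:R <= expR (v / 4) & v ^+ 3 <= 2 ^+ m].
Proof.
move=> ev; have e1 := expR_ge1Dx (1 : R).
have v0 : 0 < v by lra.
have lnv1 : 1 <= ln v by rewrite -[1]expRK ler_ln ?posrE ?expR_gt0.
pose t := v / (32 * ln v).
have t0 : 0 <= t by rewrite divr_ge0 //; lra.
have tE : t * (32 * ln v) = v by rewrite divfK // lt0r_neq0 //; lra.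
have [z zE] : exists z, z = Num.truncn (expR t) by exists (Num.truncn (expR t)).
have zle : z%:R <= expR t by rewrite zE truncn_le expR_ge0.
have zlt : expR t < z.+1%:R by rewrite zE; exact: truncnS_gt.
have z0 : (0 < z)%N by rewrite zE truncn_gt0 -expR0 ler_expR.
have [M [M1 M2]] : exists M, 3 * ln v <= M%:R /\ M%:R <= 4 * ln v.
  exists (Num.truncn (3 * ln v)).+1; split; first by rewrite ltW // truncnS_gt.
  have : (Num.truncn (3 * ln v))%:R <= 3 * ln v by rewrite truncn_le; lra.
  by rewrite -natr1; lra.
exists z, M.*2; split; rewrite ?odd_double //.
- by rewrite -/t -[t]expRK ler_ln ?posrE ?expR_gt0 ?ltr0n // ltW.
- split; first by apply: le_trans zle _; rewrite ler_expR; nra.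
  rewrite natrX; apply: le_trans (_ : expR t ^+ M.*2 <= _).
    by rewrite lerXn2r ?nnegrE ?ler0n ?expR_ge0.
  by rewrite -expRM_natl ler_expR -mul2n natrM; nra.
rewrite -mul2n exprM -[v in v ^+ 3]lnK ?posrE // -expRM_natl.
apply: le_trans (_ : expR (M%:R * 1) <= _); first by rewrite ler_expR mulr1.
have e4 : expR 1 <= 2 ^+ 2 :> R by have := expR1_le4 R; lra.
by rewrite expRM_natl lerXn2r // nnegrE ?expR_ge0 ?sqr_ge0.
Qed.

Lemma quartic_lt_length (R : realType) (g L : nat) (y : R) : (2 <= g)%N ->
  640 * g%:R ^+ 3 <= y -> y ^+ 4 <= 4 * g%:R * L%:R -> y < L%:R.
Proof.
move=> g2 y_large yL; have g2R : 2 <= g%:R :> R by rewrite ler_nat.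
have g0 : 0 < 4 * g%:R :> R by lra.
have g3 : 4 * g%:R < 640 * g%:R ^+ 3 :> R by rewrite !exprS expr0; nra.
have y0 : 0 < y by lra.
have y3 : 4 * g%:R < y ^+ 3.
  by apply: (@lt_le_trans _ _ y); [lra|rewrite !exprS expr0; nra].
by rewrite -(ltr_pM2l g0); apply: lt_le_trans yL; rewrite exprSr ltr_pM2r.
Qed.

(** As D <= y and L >= y^4 / (4 g), the decay exponent is at least y^2 / (128 g^3) >= 5 y, with 640
    = 5 * 128. The factor [2 ^+ s] costs at most exp (y + 1), and 4 y - 1 >= v. *)
Lemma sieve_error_le (R : realType) (g L D s : nat) (v : R) (y := expR (v / 4)) :
  (2 <= g)%N -> (0 < D)%N -> 640 * g%:R ^+ 3 <= y ->
  expR v <= 4 * g%:R * L%:R -> D%:R <= y -> s%:R <= y + 1 ->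
  2 ^+ s * expR (- ((L %/ 4)%:R / (4 * g%:R ^+ 2 * D%:R ^+ 2))) <= expR (- v).
Proof.
move=> g2 D0 y_large expv Dy sy.
have y4 : y ^+ 4 = expR v by rewrite -expRM_natl; congr expR; field.
have yv : 1 + v / 4 <= y by exact: expR_ge1Dx.
have y0 : 0 < y by exact: expR_gt0.
have g0 : 0 < g%:R :> R by rewrite ltr0n ltnW.
have g1 : 1 <= g%:R ^+ 3 :> R by rewrite exprn_ege1 // ler1n ltnW.
have Ly : y < L%:R by apply: quartic_lt_length y_large _; rewrite ?y4.
apply: le_trans (_ : expR (y + 1) * expR (- (5 * y)) <= _); last first.
  by rewrite -expRD ler_expR; lra.
apply: ler_pM; rewrite ?exprn_ge0 ?expR_ge0 //.
  apply: le_trans (_ : expR 1 ^+ s <= _).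
    rewrite lerXn2r // ?nnegrE ?expR_ge0 //.
    by have := expR_ge1Dx (1 : R); lra.
  by rewrite -expRM_natl mulr1 ler_expR.
rewrite ler_expR lerN2.
have L4 : L%:R / 8 <= (L %/ 4)%:R :> R.
  have : (8 <= L)%N by rewrite -(ler_nat R); lra.
  by rewrite ler_pdivrMr // -natrM ler_nat; clear; lia.
have den0 : 0 < 4 * g%:R ^+ 2 * D%:R ^+ 2 :> R.
  by rewrite !mulr_gt0 ?exprn_gt0 // ltr0n.
rewrite ler_pdivlMr //; apply: le_trans L4; rewrite ler_pdivlMr //.
have D2 : D%:R ^+ 2 <= y ^+ 2 by rewrite lerXn2r // nnegrE ?ler0n // ltW.
rewrite -(ler_pM2l (_ : 0 < 4 * g%:R)) ?mulr_gt0 //.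
apply: le_trans expv; rewrite -y4.
have -> : 4 * g%:R * (5 * y * (4 * g%:R ^+ 2 * D%:R ^+ 2) * 8)
   = 640 * g%:R ^+ 3 * y * D%:R ^+ 2 by ring.
have -> : y ^+ 4 = y * y * y ^+ 2 by ring.
apply: ler_pM; [|exact: sqr_ge0|exact: (ler_wpM2r (ltW y0) y_large)|exact: D2].
apply: mulr_ge0; last exact: ltW.
apply: mulr_ge0; [exact: ler0n|exact: exprn_ge0 (ltW g0)].
Qed.

(** A prime that is at least [g ^ L.-1] exceeds z, so no sieving prime divides it. The sieve gives 2
    eta X, and its error is at most eta X. *)
Lemma count_prime_digit_sums (R : realType) (g L : nat) (v : R) : (2 <= g)%N ->
  expR 1 + 2560 * g%:R ^+ 3 <= v -> expR v <= 4 * g%:R * L%:R ->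
  (count (fun n => prime n && (g ^ L.-1 <= n)%N)
         (digit_sums g (palindrome_weights g L)))%:R
    <= 3 * sieve_density g v * (g ^ uphalf L)%:R.
Proof.
move=> g2 v_large expv.
set eta := sieve_density g v; set X : R := (g ^ uphalf L)%:R.
set vs := digit_sums _ _; set B := bad_modulus g.
have X0 : 0 <= X by exact: ler0n.
have g3 : 1 <= g%:R ^+ 3 :> R by rewrite exprn_ege1 // ler1n ltnW.
have e1 := expR_ge1Dx (1 : R).
have ev : expR 1 <= v by lra.
have v0 : 0 < v by lra.
have lnv1 : 1 <= ln v by rewrite -[1]expRK ler_ln ?posrE ?expR_gt0.
have eta_ge : 2 / v <= eta by exact: sieve_density_ge.
have eta0 : 0 < eta by apply: lt_le_trans eta_ge; rewrite divr_gt0.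
(* For eta > 1 the bound is trivial; [prefix_prod_between] requires eta <= 1. *)
have [eta1|eta1] := ltP 1 eta.
  apply: le_trans (_ : X <= _); last by rewrite ler_peMl //; lra.
  rewrite /X -(size_palindrome_weights g L) -size_digit_sums ler_nat.
  exact: count_size.
(* From exp (v / 4) >= v / 4 and 2560 = 4 * 640. *)
have y_large : 640 * g%:R ^+ 3 <= expR (v / 4).
  by have := expR_ge1Dx (v / 4); lra.
have [z [m [z0 em lnz [zy zmy] v3m]]] := sieve_parameters ev.
have power_large : 4 <= eta ^+ 3 * 2 ^+ m.+1.
  have v3 : (2 / v) ^+ 3 * v ^+ 3 = 8 by field; rewrite lt0r_neq0.
  have : 8 <= eta ^+ 3 * 2 ^+ m.
    have v2 : 0 <= 2 / v by rewrite divr_ge0 // ltW.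
    rewrite -v3 ler_pM ?exprn_ge0 // ?(ltW v0) //.
    by rewrite lerXn2r // nnegrE ltW.
  by rewrite (exprS (2 : R) m) mulrCA; set w := eta ^+ 3 * _; lra.
pose l0 := [seq p <- iota 0 z.+1 | prime p && coprime p B].
have prod_l0 : \prod_(p <- l0) (1 - p%:R^-1) <= eta.
  have := prod_coprime_primes_le R (bad_modulus_gt0 g2) z0; rewrite -/B -/l0.
  set P := \prod_(_ <- _) _ => h.
  have P0 : 0 <= P.
    rewrite /P big_filter prodr_ge0 // => p /andP[pp _].
    by rewrite subr_ge0 invf_le1 ?ler1n ?ltr0n ?prime_gt0.
  have lnv0 : 0 < ln v by exact: lt_le_trans lnv1.
  have t0 : 0 < v / (32 * ln v) by rewrite divr_gt0 // mulr_gt0.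
  have : P * (v / (32 * ln v)) <= 2 ^+ B.+1.
    by apply: le_trans h; rewrite ler_wpM2l.
  rewrite -ler_pdivlMr // => /le_trans; apply.
  (* [sieve_constant] is chosen to make this an equality. *)
  rewrite /eta /sieve_density /sieve_constant -/B le_eqVlt; apply/orP; left.
  by apply/eqP; field; rewrite !lt0r_neq0.
have l0_half : {in l0, forall p, 0 <= (p%:R^-1 : R) <= 2^-1}.
  move=> p; rewrite mem_filter => /andP[/andP[pp _] _].
  rewrite invr_ge0 ler0n lef_pV2 ?posrE ?ltr0n ?prime_gt0 //.
  by rewrite ler_nat prime_gt1.
have [l [r [l0E l_prod]]] := prefix_prod_between l0_half eta1 prod_l0.
have ul : uniq l.
  have : uniq l0 by rewrite filter_uniq // iota_uniq.
  by rewrite l0E cat_uniq => /and3P[].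
have hl : {in l, forall p, [/\ prime p, (p <= z)%N & coprime p B]}.
  move=> p pl; have : p \in l0 by rewrite l0E mem_cat pl.
  by rewrite mem_filter mem_iota add0n ltnS => /andP[/andP[pp pB] /= pz].
have size_l : (size l <= z.+1)%N.
  apply: leq_trans (_ : size l0 <= _)%N; first by rewrite l0E size_cat leq_addr.
  by rewrite size_filter -[leqRHS](size_iota 0) count_size.
pose D := (z ^ m)%N.
have D0 : (0 < D)%N by rewrite expn_gt0 z0.
pose eps := X * expR (- ((L %/ 4)%:R / (4 * g%:R ^+ 2 * D%:R ^+ 2))).
have equi d : (0 < d)%N -> (d <= D)%N -> coprime d B ->
    `|(count (dvdn d) vs)%:R - X / d%:R| <= eps.
  move=> d0 dD dB; apply: le_trans (count_digit_sums_dvdn R L g2 d0 dB) _.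
  rewrite -/X ler_wpM2l // ler_expR lerN2 ler_wpM2l //.
  have gg : 0 < 4 * g%:R ^+ 2 :> R by rewrite mulr_gt0 // exprn_gt0 // ltr0n ltnW.
  rewrite lef_pV2 ?posrE ?(mulr_gt0 gg) ?exprn_gt0 ?ltr0n // ler_pM2l //.
  by rewrite lerXn2r ?nnegrE ?ler0n // ler_nat.
have err_le : 2 ^+ size l * eps <= eta * X.
  rewrite /eps mulrCA mulrC ler_wpM2r //; apply: le_trans (_ : expR (- v) <= _).
    apply: sieve_error_le => //.
    by apply: le_trans (_ : z.+1%:R <= _); [rewrite ler_nat|rewrite -natr1 lerD2r].
  apply: le_trans eta_ge; rewrite expRN -[leLHS]mul1r ler_pM ?invr_ge0 ?expR_ge0 //.
    by rewrite ler1n.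
  rewrite lef_pV2 ?posrE ?expR_gt0 //; apply: le_trans (expR_ge1Dx v).
  by rewrite lerDr.
have zL : (z < g ^ L.-1)%N.
  have zL : (z < L)%N.
    rewrite -(ltr_nat R); apply: le_lt_trans zy (quartic_lt_length g2 y_large _).
    by rewrite -expRM_natl (_ : 4%:R * _ = v) //; field.
  by apply: leq_trans zL _; case: (L) => // k /=; rewrite ltn_expl.
apply: le_trans (_ : (count (fun n => ~~ has (fun p => p %| n)%N l) vs)%:R <= _).
  rewrite ler_nat; apply: sub_count => n /andP[pn Ln].
  apply/hasPn => p pl; have [pp pz _] := hl p pl; rewrite dvdn_prime2 //.
  by apply/eqP => pE; move: zL; rewrite ltnNge (leq_trans Ln) // -pE.
have := brun_sieve z0 equi em X0 eta0 power_large (leqnn _) ul hl l_prod.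
have -> : 3 * eta * X = 2 * eta * X + eta * X by ring.
by move=> /le_trans; apply; rewrite lerD2l.
Qed.

(** * Counting palindromes *)

Section DigitExpansions.
Local Open Scope nat_scope.

Lemma sum_folded (F : nat -> nat) L :
  \sum_(k < L) F k
    = (if odd L then F L./2 else 0) + \sum_(0 <= k < L./2) (F k + F (L.-1 - k)).
Proof.
elim/ltn_ind: L F => -[|[|L]] IH F.
- by rewrite big_ord0 big_geq.
- by rewrite big_ord1 big_geq // addn0.
rewrite big_ord_recl big_ord_recr /= (eq_bigr (fun k : 'I_L => F k.+1)) //.
rewrite (IH L _ (fun k => F k.+1)) //= negbK [in RHS]big_nat_recl // subn0 /=.
rewrite addnC -addnA addnAC addnA [F 0 + _]addnC.
have -> : \sum_(0 <= i < L./2) (F i.+1 + F (L.-1 - i).+1)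
        = \sum_(0 <= i < L./2) (F i.+1 + F (L.+1 - i.+1)).
  apply: eq_big_nat => k /andP[_ kL].
  by congr (_ + F _); lia.
by rewrite /bump /= add1n !addnA.
Qed.

Lemma mem_digit_sums_iota g (w a : nat -> nat) j h :
  (forall k, k < j + h -> a k < g) ->
  \sum_(j <= k < j + h) a k * w k \in digit_sums g [seq w k | k <- iota j h].
Proof.
elim: h j => [|h IH] j ag /=; first by rewrite addn0 big_geq // inE.
rewrite big_ltn ?addnS ?ltnS ?leq_addr // -addSn.
apply/allpairsP; exists (a j, \sum_(j.+1 <= k < j.+1 + h) a k * w k) => /=.
split=> //; first by rewrite mem_iota ag //; lia.
by apply: IH => k kj; apply: ag; lia.
Qed.

Lemma palindrome_mem_digit_sums g n L a : base_repr g n L a ->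
  (forall k, k < L -> a k = a (L.-1 - k)) ->
  n \in digit_sums g (palindrome_weights g L).
Proof.
move=> [L0 ag _ ->] pal; rewrite (sum_folded (fun k => a k * g ^ k)).
have -> : \sum_(0 <= k < L./2) (a k * g ^ k + a (L.-1 - k) * g ^ (L.-1 - k))
        = \sum_(0 <= k < L./2) a k * palindrome_weight g L k.
  apply: eq_big_nat => k /andP[_ kL].
  by rewrite -pal ?mulnDr //; lia.
have mem := @mem_digit_sums_iota g (palindrome_weight g L) a 0 L./2 _.
rewrite add0n in mem; rewrite /palindrome_weights.
case: (odd L); rewrite /= ?add0n; last by apply: mem => k kL; apply: ag; lia.
apply/allpairsP; exists (a L./2, \sum_(0 <= k < L./2) a k * palindrome_weight g L k).
split=> //=; first by rewrite mem_iota ag //; lia.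
by apply: mem => k kL; apply: ag; lia.
Qed.

Lemma digit_expansion_ltn g L a : (forall k, k < L -> a k < g) ->
  \sum_(k < L) a k * g ^ k < g ^ L.
Proof.
elim: L => [|L IH] ag; first by rewrite big_ord0.
rewrite big_ord_recr /= expnS.
have h1 : \sum_(k < L) a k * g ^ k < g ^ L by apply: IH => k kL; apply: ag; lia.
have h2 : (a L).+1 * g ^ L <= g * g ^ L by rewrite leq_mul2r ag ?orbT.
by apply: leq_trans h2; rewrite mulSn ltn_add2r.
Qed.

Lemma base_repr_geq g n L a : base_repr g n L a -> g ^ L.-1 <= n.
Proof.
case: L => [[]//|L] [_ ag /eqP aL ->]; rewrite big_ord_recr /=.
by apply: leq_trans (leq_addl _ _); rewrite leq_pmull // lt0n.
Qed.

Lemma digit_expansion_mod g c h : 0 < g ->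
  \sum_(k < h) (c %/ g ^ k) %% g * g ^ k = c %% g ^ h.
Proof.
move=> g0; elim: h => [|h IH]; first by rewrite big_ord0 expn0 modn1.
rewrite big_ord_recr /= IH.
have E : c = c %/ g ^ h %/ g * g ^ h.+1 + ((c %/ g ^ h) %% g * g ^ h + c %% g ^ h).
  rewrite expnS addnA mulnA -mulnDl -divn_eq; exact: divn_eq.
rewrite [X in _ = X %% _]E modnMDl [RHS]modn_small; first exact: addnC.

have h1 : c %% g ^ h < g ^ h by rewrite ltn_mod expn_gt0 g0.
have h2 : ((c %/ g ^ h) %% g).+1 * g ^ h <= g * g ^ h.
  by rewrite leq_mul2r ltn_mod g0 orbT.
by rewrite expnS; apply: leq_trans h2; rewrite mulSn addnC ltn_add2r.
Qed.

(** The exponent is the distance from k to the nearer end: the lower half of the digits is read off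
    c, and the upper half reflects it. *)
Definition mirrored_digit g K c k := (c %/ g ^ minn k (K.-1 - k)) %% g.
Definition mirror g K c := \sum_(k < K) mirrored_digit g K c k * g ^ k.

Lemma mirror_repr g K c : 0 < K -> 0 < g -> c %% g != 0 ->
  base_repr g (mirror g K c) K (mirrored_digit g K c).
Proof.
move=> K0 g0 cg; split=> // [k _|]; first by rewrite ltn_mod.
by apply/eqP; rewrite /mirrored_digit subnn minn0 expn0 divn1.
Qed.

Lemma mirror_palindrome g K c : 0 < K -> 0 < g -> c %% g != 0 ->
  palindrome g (mirror g K c).
Proof.
move=> K0 g0 cg; exists K, (mirrored_digit g K c); split; first exact: mirror_repr.
move=> k kK; rewrite /mirrored_digit.
by have -> : minn (K.-1 - k) (K.-1 - (K.-1 - k)) = minn k (K.-1 - k) by lia.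
Qed.

Lemma mirror_ltn g K c : 0 < g -> mirror g K c < g ^ K.
Proof. by move=> g0; apply: digit_expansion_ltn => k _; rewrite ltn_mod. Qed.

(** The lowest [uphalf K] digits of the mirror are those of c, and the other terms vanish modulo
    [g ^ uphalf K]. This serves as injectivity of [mirror]. *)
Lemma mirror_mod g K c : 0 < g -> c < g ^ uphalf K -> mirror g K c %% g ^ uphalf K = c.
Proof.
move=> g0 cK; rewrite /mirror.
rewrite -(big_mkord xpredT (fun k => mirrored_digit g K c k * g ^ k)).
rewrite (big_cat_nat (n := uphalf K)) //=; last by lia.
rewrite (eq_big_nat _ _ (F2 := fun k => (c %/ g ^ k) %% g * g ^ k)); last first.
  move=> k /andP[_ kK]; rewrite /mirrored_digit.
  by have -> : minn k (K.-1 - k) = k by lia.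
rewrite big_mkord digit_expansion_mod // modnDml.
have /dvdnP[q ->] : g ^ uphalf K %|
    \sum_(uphalf K <= k < K) mirrored_digit g K c k * g ^ k.
  rewrite big_nat_cond; apply: dvdn_sum => k /andP[/andP[hk _] _].
  by rewrite dvdn_mull // dvdn_exp2l.
by rewrite addnC modnMDl modn_small.
Qed.

(** The terms gain a factor g every two steps; the constant 4 survives the induction because 4 + 2 g
    <= 4 g. *)
Lemma sum_expn_uphalf g N : 2 <= g ->
  \sum_(L < N.+1) g ^ uphalf L <= 4 * g ^ uphalf N.
Proof.
move=> g2; elim/ltn_ind: N => -[|[|N]] IH.
- by rewrite big_ord1.
- by rewrite !big_ord_recr big_ord0 /=; lia.
rewrite 2!big_ord_recr /=; have /= := IH N (ltnW (ltnSn _)).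
have : g ^ (N./2).+1 <= g ^ (uphalf N).+1.
  by rewrite leq_exp2l // ltnS uphalf_half leq_addl.
rewrite !expnS; move: (g ^ uphalf N) (\sum_(_ < _) _) => a b; nia.
Qed.
End DigitExpansions.

(** * Bounds for both counting functions, and the conclusion *)

Lemma size_le_fset_set (A : set nat) (s : seq nat) : finite_set A ->
  uniq s -> (forall n, n \in s -> A n) -> (size s <= #|` fset_set A|)%N.
Proof.
move=> Af us sA; apply: uniq_leq_size => // n /sA An.
by rewrite in_fset_set //; exact: mem_set.
Qed.

Lemma fset_set_le_size (A : set nat) (s : seq nat) : finite_set A ->
  (forall n, A n -> n \in s) -> (#|` fset_set A| <= size s)%N.
Proof.
move=> Af As; apply: uniq_leq_size => // n.
by rewrite in_fset_set // inE; exact: As.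
Qed.

Lemma card_palindromes_ge (R : realType) (g K : nat) (x : R) : (2 <= g)%N ->
  (0 < K)%N -> (g ^ K)%:R <= x ->
  (g ^ (uphalf K).-1 <= #|` fset_set (palindromes_le g x)|)%N.
Proof.
move=> g2 K0 Kx; have g0 : (0 < g)%N by exact: ltnW.
(* The lowest digit is 1 so that its mirror image, the leading digit, is nonzero; the other
   [(uphalf K).-1] digits are free. *)
pose s := [seq mirror g K (1 + j * g) | j <- iota 0 (g ^ (uphalf K).-1)].
have <- : size s = (g ^ (uphalf K).-1)%N by rewrite size_map size_iota.
have small j : (j < g ^ (uphalf K).-1)%N -> (1 + j * g < g ^ uphalf K)%N.
  move=> jK; have -> : uphalf K = (uphalf K).-1.+1 by case: (K) K0.
  by rewrite expnSr; move: (g ^ _)%N jK => G; nia.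
apply: size_le_fset_set; first exact: finite_palindromes_le.
  rewrite map_inj_in_uniq ?iota_uniq // => i j; rewrite !mem_iota !add0n /=.
  move=> /small iK /small jK /(congr1 (modn^~ (g ^ uphalf K)%N)).
  rewrite !mirror_mod // => /addnI /eqP.
  by rewrite eqn_pmul2r // => /eqP.
move=> n /mapP[j _ ->]; split.
  by apply: mirror_palindrome => //; rewrite addnC modnMDl modn_small.
apply: le_trans Kx; rewrite ler_nat ltnW // mirror_ltn //.
Qed.

(** Palindromes of length at most K lie below [g ^ K]. A longer one is a digit sum for its length L,
    and L <= N since [g ^ L.-1 <= n < g ^ N]. *)
Lemma card_prime_palindromes_le (R : realType) (g N K : nat) (x : R) :
  (2 <= g)%N -> x < (g ^ N)%:R ->
  (#|` fset_set (prime_palindromes_le g x)| <= g ^ K +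
     \sum_(K <= L < N.+1) count (fun n => prime n && (g ^ L.-1 <= n))
        (digit_sums g (palindrome_weights g L)))%N.
Proof.
move=> g2 xN; pose p L n := prime n && (g ^ L.-1 <= n)%N.
pose s := iota 0 (g ^ K) ++
  flatten [seq [seq n <- digit_sums g (palindrome_weights g L) | p L n]
          | L <- index_iota K N.+1].
have -> : (g ^ K + \sum_(K <= L < N.+1) count (p L)
    (digit_sums g (palindrome_weights g L)))%N = size s.
  rewrite size_cat size_iota size_flatten /shape -map_comp sumnE big_map.
  by congr addn; apply: eq_bigr => L _; rewrite /= size_filter.
apply: fset_set_le_size; first exact: finite_prime_palindromes_le.
move=> n [[[L [a [rep pal]]] nx] pn]; rewrite mem_cat mem_iota /= add0n.
have nL : (n < g ^ L)%N.
  by case: rep => _ ag _ ->; exact: digit_expansion_ltn.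
have [LK|KL] := leqP L K.
  by rewrite (leq_trans nL) // leq_exp2l.
apply/orP; right; apply/flattenP.
exists ([seq n <- digit_sums g (palindrome_weights g L) | p L n]).
  apply/mapP; exists L => //; rewrite mem_index_iota (ltnW KL) ltnS /=.
  have : (g ^ L.-1 < g ^ N)%N.
    apply: leq_ltn_trans (base_repr_geq rep) _.
    by rewrite -(ltr_nat R); exact: le_lt_trans xN.
  by rewrite ltn_exp2l // ; case: (L) => //.
by rewrite mem_filter (palindrome_mem_digit_sums rep pal) /p pn (base_repr_geq rep).
Qed.

(** Lengths L > N / 4 satisfy N <= 4 L, the source of the 4 in [expR v <= 4 * g%:R * L%:R]; shorter
    ones are counted trivially. The constant is 13 = 1 + 3 * 4, with 3 from the sieve and 4 from the
    sum over lengths. *)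
Lemma prime_palindromes_bound (R : realType) (g N : nat) (x v : R) : (2 <= g)%N ->
  x < (g ^ N)%:R -> expR v <= g%:R * N%:R -> expR 1 + 2560 * g%:R ^+ 3 <= v ->
  #|` fset_set (prime_palindromes_le g x)|%:R
    <= 13 * sieve_density g v * (g ^ uphalf N)%:R.
Proof.
move=> g2 xN expv v_large; pose K := (N %/ 4)%N.
have g2R : 2 <= g%:R :> R by rewrite ler_nat.
have g3 : g%:R <= g%:R ^+ 3 :> R by rewrite !exprS expr0; nra.
have e1 := expR_ge1Dx (1 : R).
have v0 : 0 < v by lra.
have lnv1 : 1 <= ln v.
  by rewrite -[1]expRK ler_ln ?posrE ?expR_gt0 //; lra.
have := sieve_density_ge g v0 lnv1; set eta := sieve_density g v => eta_ge.
have eta0 : 0 <= eta by apply: le_trans eta_ge; rewrite divr_ge0 // ltW.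
have N4 : (N < 4 * K.+1)%N by rewrite /K mulnC -ltn_divLR.
(* The spare factor [g ^ K.-1] is at least K >= v, which makes up for the density 2 / v. *)
have exponent_le : (0 < K)%N -> (K.+1 + K.-1 <= uphalf N)%N.
  by rewrite /K; clear; lia.
have vK : v <= K%:R.
  have v2 : 1 + v ^+ 2 / 2 <= expR v by exact: (expR_ge1Dxn 1 (ltW v0)).
  have : N%:R <= 4 * K%:R + 4 :> R.
    rewrite -natrM -natrD ler_nat; apply: leq_trans (ltnW N4) _.
    by rewrite mulnS addnC.
  nra.
have small : (g ^ K.+1)%:R <= eta * (g ^ uphalf N)%:R.
  have K0 : (0 < K)%N by rewrite -(ltr_nat R); lra.
  apply: le_trans (_ : (2 / v) * (g ^ (K.+1 + K.-1))%:R <= _); last first.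
    rewrite ler_pM ?divr_ge0 ?ler0n // ?(ltW v0) //.
    by rewrite ler_nat leq_exp2l // exponent_le.
  rewrite expnD natrM mulrCA ler_peMr //.
  rewrite mulrAC ler_pdivlMr // mul1r.
  have : K%:R <= (g ^ K.-1)%:R :> R.
    by rewrite ler_nat; case: (K) K0 => // k _; rewrite ltn_expl.
  lra.
apply: le_trans (_ : _ <= eta * (g ^ uphalf N)%:R
    + 3 * eta * (4 * g ^ uphalf N)%:R) _; last first.
  by rewrite natrM; lra.
have := card_prime_palindromes_le K.+1 g2 xN; rewrite -(ler_nat R).
move=> /le_trans; apply; rewrite natrD lerD //.
apply: le_trans (_ : _ <= \sum_(K.+1 <= L < N.+1) 3 * eta * (g ^ uphalf L)%:R) _.
  rewrite natr_sum big_nat [leRHS]big_nat; apply: ler_sum => L /andP[KL _].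
  apply: count_prime_digit_sums => //; apply: le_trans expv _.
  rewrite [4 * _]mulrC -mulrA ler_wpM2l ?ler0n // -natrM ler_nat.
  by apply: leq_trans (ltnW N4) _; rewrite leq_mul2l.
rewrite -mulr_sumr; apply: ler_wpM2l.
  by apply: mulr_ge0 eta0; exact: ler0n.
rewrite -natr_sum ler_nat.
apply: leq_trans (sum_expn_uphalf N g2).
rewrite -(big_mkord xpredT (fun L => g ^ uphalf L)%N).
have [KN|NK] := leqP K.+1 N.+1; last by rewrite big_geq // ltnW.
by rewrite [leqRHS](big_cat_nat (n := K.+1)) //= leq_addl.
Qed.

Theorem theorem5p1 (R : realType) (g : nat) (hg : (2 <= g)%N) :
  exists2 C : R, 0 < C &
    \forall x \near +oo_R,
      #|` fset_set (prime_palindromes_le g x)|%:R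
        <= C * (#|` fset_set (palindromes_le g x)|%:R
                * (ln (ln (ln x)) / ln (ln x))).
Proof.
have g0 : 0 < g%:R :> R by rewrite ltr0n ltnW.
pose A : R := sieve_constant R g.
have A0 : 0 < A by rewrite /A /sieve_constant mulr_gt0 // exprn_gt0.
exists (13 * A * g%:R ^+ 2); first by rewrite !mulr_gt0 // exprn_gt0.
pose v1 : R := expR 1 + 2560 * g%:R ^+ 3.
have v1_ge1 : 1 <= v1.
  have : 0 <= 2560 * g%:R ^+ 3 :> R.
    by apply: mulr_ge0; [exact: ler0n|exact: exprn_ge0 (ltW g0)].
  by have := expR_ge1Dx (1 : R); rewrite /v1; lra.
(* The threshold makes ln (ln x) at least v1; its summand g makes K positive. *)
exists (expR (expR v1) + g%:R); split; first exact: num_real.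
move=> x x_large; have ee0 := expR_gt0 (expR v1).
have x0 : 0 < x by lra.
have lnx : expR v1 < ln x by rewrite -[ltLHS]expRK ltr_ln ?posrE ?expR_gt0 //; lra.
have lnx0 : 0 < ln x by apply: lt_trans lnx; exact: expR_gt0.
pose v := ln (ln x).
have v_large : v1 <= v by rewrite -[v1]expRK ler_ln ?posrE ?expR_gt0 // ltW.
have v0 : 0 < v by exact: lt_le_trans ltr01 (le_trans v1_ge1 v_large).
pose n := Num.truncn x; pose K := trunc_log g n.
have n_le : n%:R <= x by rewrite truncn_le ltW.
have n_ge : (g <= n)%N by rewrite truncn_ge_nat ?(ltW x0) //; lra.
have K0 : (0 < K)%N by rewrite trunc_log_gt0 hg /=; case: (g) hg n_ge.
have xN : x < (g ^ K.+1)%:R.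
  apply: lt_le_trans (truncnS_gt x) _; rewrite ler_nat; exact: trunc_log_ltn.
have Kx : (g ^ K)%:R <= x.
  apply: le_trans n_le; rewrite ler_nat trunc_logP //.
  by apply: leq_trans n_ge; exact: ltnW.
(* Here exp v = ln x <= (K + 1) ln g, and ln g <= g - 1. *)
have expv : expR v <= g%:R * K.+1%:R.
  rewrite /v lnK ?posrE //.
  apply: le_trans (_ : ln ((g ^ K.+1)%:R : R) <= _).
    by rewrite ler_ln ?posrE // ?(ltW xN) // (lt_trans x0).
  rewrite natrX lnXn // -[leLHS]mulr_natl [leRHS]mulrC ler_wpM2l //.
  have : -1 < g%:R - 1 :> R by lra.
  by move=> /le_ln1Dx; rewrite addrC subrK; lra.
apply: le_trans (prime_palindromes_bound hg xN expv v_large) _.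
(* Passing to the exponent [(uphalf K).-1] of the lower bound for all palindromes costs the factor
   g^2 of the constant. *)
have uphalf_le k : (uphalf k.+1 <= 2 + (uphalf k).-1)%N by clear; lia.
have P_ge : (g ^ uphalf K.+1)%:R <= g%:R ^+ 2
     * #|` fset_set (palindromes_le g x)|%:R :> R.
  apply: le_trans (_ : (g ^ 2 * g ^ (uphalf K).-1)%:R <= _).
    by rewrite ler_nat -expnD (leq_exp2l _ _ hg); exact: uphalf_le.
  by rewrite natrM natrX ler_wpM2l ?sqr_ge0 // ler_nat card_palindromes_ge.
rewrite /sieve_density -/A -/v.
have lnv0 : 0 <= ln v / v.
  apply: divr_ge0; last exact: ltW.
  exact: ln_ge0 (le_trans v1_ge1 v_large).
have -> : 13 * A * g%:R ^+ 2 * (#|` fset_set (palindromes_le g x)|%:R * (ln v / v))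
   = 13 * (A * (ln v / v)) * (g%:R ^+ 2 * #|` fset_set (palindromes_le g x)|%:R) by ring.
apply: ler_wpM2l P_ge; apply: mulr_ge0; first exact: ler0n.
exact: mulr_ge0 (ltW A0) lnv0.
Qed.
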